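(* Let $(X,T)$ be a topological dynamical system and let $f\in C(X)$ be a continuous real-valued function. Let $\{N_\delta:\delta>0\}$ be any fixed family of positive integers, used in the definition of the sets of Feldman-Katok pseudo-orbits. Then $$PFKPO(X,T,f)=P(X,T,f),$$ where $PFKPO(X,T,f)$ is the topological pressure with respect to Feldman-Katok pseudo-orbits and $P(X,T,f)$ is the classical topological pressure.
   Context: A topological dynamical system (TDS) is a pair $(X,T)$ where $X$ is a compact metric space with metric $d$ and $T:X\to X$ is a continuous map. Elements of $X^{\mathbb N}$ are sequences $\mathbf x=(x_0,x_1,\ldots)$ indexed from $0$. FK-pseudo-chains. Let $n\geq 1$ be an integer and $\alpha,\delta>0$. A tuple $(x_0,x_1,\ldots,x_{n-1})\in X^n$ is an FK-$\alpha$-pseudo-chain of density $1-\delta$ if there exist a positive integer $k$ with $(1-\delta)n<k\leq n$ and integers $0\leq i_1<i_2<\ldots<i_k\leq n-1$ and $0\leq j_1<j_2<\ldots<j_k\leq n-1$ such that $d(T^{j_{t+1}-j_t}(x_{i_t}),x_{i_{t+1}})\leq\alpha$ for $t=1,\ldots,k-1$. FK-pseudo-orbits. A positive integer $N_\delta$ is fixed for each $\delta>0$. A sequence $(x_0,x_1,\ldots)\in X^{\mathbb N}$ is an FK-$\alpha$-pseudo-orbit of density $1-\delta$ controlled by $N_\delta$ if there is a sequence of integers $0\leq s_0<s_1<\ldots<s_i<\ldots$ with $s_0\leq N_\delta$ and $s_{i+1}-s_i\leq N_\delta$ for all $i\geq 0$, such that for all $m>n\geq 0$ the tuple $(x_{s_n},x_{s_n+1},\ldots,x_{s_m-1})$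 is an FK-$\alpha$-pseudo-chain of density $1-\delta$. The set of all of these is denoted $FKPO_{\alpha,\delta}$. Spanning sets in $X^{\mathbb N}$. For $Y\subset X^{\mathbb N}$, $n\ge 1$ and $\epsilon>0$, a set $F\subset Y$ is an $(n,\epsilon)$-spanning set of $Y$ if for every $\mathbf x\in Y$ there is $\mathbf y\in F$ with $d(x_i,y_i)<\epsilon$ for $0\leq i\leq n-1$. Pressure with respect to FK-pseudo-orbits. Define $$FKPOsp_{n,\epsilon;\alpha,\delta}(X,T,f)=\inf\Big\{\sum_{\mathbf x\in F}e^{\sum_{i=0}^{n-1}f(x_i)}: F\text{ is an }(n,\epsilon)\text{-spanning set of }FKPO_{\alpha,\delta}\Big\},$$ $$PFKPO(X,T,f,\epsilon,\delta)=\inf_{\alpha>0}\limsup_{n\to\infty}\frac1n\log FKPOsp_{n,\epsilon;\alpha,\delta}(X,T,f),$$ $$PFKPO(X,T,f,\epsilon)=\limsup_{\delta\to0}PFKPO(X,T,f,\epsilon,\delta),\qquad PFKPO(X,T,f)=\lim_{\epsilon\to0}PFKPO(X,T,f,\epsilon);$$ the last limit exists because $PFKPO(X,T,f,\epsilon)$ is non-increasing in $\epsilon$. Classical pressure. Let $d_n(x,y)=\max_{0\leq i\leq n-1}d(T^ix,T^iy)$. A set $F\subset X$ is an $(n,\epsilon)$-spanning set of $X$ if for every $x\in X$ there is $y\in F$ with $d_n(x,y)\leq\epsilon$. Let $$sp_{n,\epsilon}(X,T,f)=\inf\Big\{\sum_{x\in F}e^{\sum_{i=0}^{n-1}f(T^ix)}:F\text{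 is an }(n,\epsilon)\text{-spanning set of }X\Big\},$$ $$P(X,T,f)=\lim_{\epsilon\to0}\limsup_{n\to\infty}\frac1n\log sp_{n,\epsilon}(X,T,f).$$ *)

(* Defs.v *)
From mathcomp Require Export all_boot all_order all_algebra.
From mathcomp Require Export all_classical all_reals all_analysis.
Export numFieldNormedType.Exports.

Set Implicit Arguments.
Unset Strict Implicit.
Unset Printing Implicit Defensive.

Import Order.TTheory GRing.Theory Num.Theory.

Local Open Scope classical_set_scope.
Local Open Scope ring_scope.

Section FeldmanKatokPseudoOrbits.
Context {R : realType} {X : metricType R}.
Implicit Types (T : X -> X) (x : nat -> X) (N : R -> nat).

(* The subtraction [j b - j a] is truncated, but [j] is strictly increasing. *)
Definition FK_pseudo_chain T (alpha delta : R) (n : nat) (u : 'I_n -> X) : Prop :=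
  exists k : nat,
    [/\ (0 < k <= n)%N, (1 - delta) * n%:R < k%:R &
      exists i j : 'I_k -> 'I_n,
        [/\ {homo i : a b / (a < b)%N}, {homo j : a b / (a < b)%N} &
          forall a b : 'I_k, b = a.+1 :> nat ->
            mdist (iter (j b - j a)%N T (u (i a))) (u (i b)) <= alpha]].

Definition FK_pseudo_orbit T (alpha delta : R) (M : nat) x : Prop :=
  exists s : nat -> nat,
    [/\ {homo s : a b / (a < b)%N},
        (s 0 <= M)%N,
        forall i, (s i.+1 - s i <= M)%N &
        forall n m, (n < m)%N ->
          FK_pseudo_chain T alpha delta
            (fun l : 'I_(s m - s n) => x (s n + l)%N)].

Definition FKPO T N (alpha delta : R) : set (nat -> X) :=
  [set x | FK_pseudo_orbit T alpha delta (N delta) x].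

Definition seq_spanning (Y : set (nat -> X)) (n : nat) (eps : R)
    (F : set (nat -> X)) : Prop :=
  F `<=` Y /\
  forall x, Y x ->
    exists2 y, F y & forall i, (i < n)%N -> mdist (x i) (y i) < eps.

(* [F] ranges over arbitrary, possibly infinite, sets, and the sum is the
   unconditional sum of nonnegative terms in [0, +oo]. *)
Definition FKPOsp T (f : X -> R) N (n : nat) (eps alpha delta : R) : \bar R :=
  ereal_inf [set (\esum_(x in F) (expR (\sum_(i < n) f (x i)))%:E)%E
            | F in seq_spanning (FKPO T N alpha delta) n eps].

Definition PFKPO_eps_delta T (f : X -> R) N (eps delta : R) : \bar R :=
  ereal_inf [set limn_esup (fun n =>
                   ((n%:R^-1)%:E * lne (FKPOsp T f N n eps alpha delta))%E)
            | alpha in [set alpha : R | 0 < alpha]].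

Definition PFKPO_eps T (f : X -> R) N (eps : R) : \bar R :=
  limf_esup (fun delta => PFKPO_eps_delta T f N eps delta) 0^'+.

Definition PFKPO T (f : X -> R) N : \bar R :=
  lim (PFKPO_eps T f N eps @[eps --> 0^'+]).

End FeldmanKatokPseudoOrbits.

Section ClassicalPressure.
Context {R : realType} {X : metricType R}.
Implicit Types (T : X -> X).

(* Distances are nonnegative, so the default value 0 only matters for n = 0. *)
Definition bowen_dist T (n : nat) (x y : X) : R :=
  \big[Num.max/0]_(i < n) mdist (iter i T x) (iter i T y).

Definition spanning T (n : nat) (eps : R) (F : set X) : Prop :=
  forall x, exists2 y, F y & bowen_dist T n x y <= eps.

Definition sp T (f : X -> R) (n : nat) (eps : R) : \bar R :=
  ereal_inf [set (\esum_(x in F) (expR (\sum_(i < n) f (iter i T x)))%:E)%E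
            | F in spanning T n eps].

Definition pressure_eps T (f : X -> R) (eps : R) : \bar R :=
  limn_esup (fun n => ((n%:R^-1)%:E * lne (sp T f n eps))%E).

Definition pressure T (f : X -> R) : \bar R :=
  lim (pressure_eps T f eps @[eps --> 0^'+]).

End ClassicalPressure.

(* [lim] is a total operator: the two lemmas [is_cvg_*] below show that the
   limits defining [PFKPO] and [pressure] exist. *)

Section Existence.
Context {R : realType} {X : metricType R}.
Implicit Types (T : X -> X) (f : X -> R) (N : R -> nat).

Lemma le_ereal_inf_exists (A B : set (\bar R)) :
  (forall b, B b -> exists2 a, A a & (a <= b)%E) ->
  (ereal_inf A <= ereal_inf B)%E.
Proof.
move=> AB; apply: le_ereal_inf_tmp => b /AB[a Aa ab].
exact: le_trans (ereal_inf_lbound Aa) ab.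
Qed.

Lemma le_lne (x y : \bar R) : (x <= y)%E -> (lne x <= lne y)%E.
Proof.
move=> xy; have [x0|x0] := leP x 0%E; first by rewrite le0_lneNy ?leNye.
by rewrite lee_lne // in_itv /= ?leey ?andbT ltW //; apply: lt_le_trans xy.
Qed.

Lemma le_limf_esup (I : choiceType) (Y : filteredType I) (u v : Y -> \bar R)
    (G : set (set Y)) :
  (forall x, (u x <= v x)%E) -> (limf_esup u G <= limf_esup v G)%E.
Proof.
move=> uv; apply: le_ereal_inf_exists => _ [V GV <-].
exists (ereal_sup (u @` V)); first by exists V.
apply: ge_ereal_sup => _ [x Vx <-].
by apply: le_trans (uv x) _; apply: ereal_sup_ubound; exists x.
Qed.

Lemma PFKPO_eps_nonincreasing T f N (e1 e2 : R) : e1 <= e2 ->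
  (PFKPO_eps T f N e2 <= PFKPO_eps T f N e1)%E.
Proof.
move=> e12; apply: le_limf_esup => delta.
apply: le_ereal_inf_exists => _ [alpha a0 <-].
eexists; first by exists alpha.
apply: le_limf_esup => n; apply: lee_wpmul2l; first by rewrite lee_fin.
apply/le_lne/ereal_inf_le_tmp/image_subset => F [FY HF]; split=> // x /HF[y Fy xy].
by exists y => // i /xy /lt_le_trans; apply.
Qed.

Lemma pressure_eps_nonincreasing T f (e1 e2 : R) : e1 <= e2 ->
  (pressure_eps T f e2 <= pressure_eps T f e1)%E.
Proof.
move=> e12; apply: le_limf_esup => n; apply: lee_wpmul2l; first by rewrite lee_fin.
apply/le_lne/ereal_inf_le_tmp/image_subset => F HF x.
by have [y Fy xy] := HF x; exists y => //; apply: le_trans e12.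
Qed.

Lemma is_cvg_PFKPO_eps T f N : cvg (PFKPO_eps T f N eps @[eps --> 0^'+]).
Proof.
apply: nonincreasing_at_right_is_cvge; apply: nearW => x a b _ _ ab.
exact: PFKPO_eps_nonincreasing.
Qed.

Lemma is_cvg_pressure_eps T f : cvg (pressure_eps T f eps @[eps --> 0^'+]).
Proof.
apply: nonincreasing_at_right_is_cvge; apply: nearW => x a b _ _ ab.
exact: pressure_eps_nonincreasing.
Qed.

End Existence.

(* Main.v *)
Require Import Defs.
From mathcomp Require Import ring lra zify.
Import Order.TTheory GRing.Theory Num.Theory.
Local Open Scope classical_set_scope.
Local Open Scope ring_scope.

(** One inequality holds because true orbits are pseudo-orbits: a spanning set of
    pseudo-orbits spans the orbits, and replacing each of its elements by a nearby
    true orbit changes Birkhoff sums by at most n times the modulus of continuity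
    of [f] ([sp_le_FKPOsp], [pressure_eps_le]).

    For the other inequality fix the scale [eps] and then [delta], which fixes the
    bound [M] on the gaps of a pseudo-orbit. A pseudo-orbit is cut into windows
    whose lengths lie between [L] and [L + M] ([anchored_split]), where [L] is as
    large as desired, and each window is a pseudo-chain. If [alpha] is small with
    respect to [L + M], the matched letters of a window of length l follow a single
    true orbit ([traces_exists]), and this orbit is approximated by an element of
    an optimal (l, eps)-spanning set; the fewer than [delta * l] unmatched letters
    are approximated by a finite net. So a window is known up to [5 * eps] from the
    spanning element, the matched positions, the matched times and the net points,
    since an increasing matching is determined by its domain and its range
    ([increasing_imset_inj]). Giving each unmatched letter a weight
    [q = expR (- kappa)], the codes have total weight at most
    (1 + 2 (m + 1) q) ^ l, and undoing the weights costs [expR (2 * kappa * delta * l)];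
    both exponential rates vanish when [delta] tends to 0 and then [kappa] to
    infinity ([cover_chains]). Concatenating windows multiplies these estimates,
    and the [M + 1] possible lengths of each window contribute a rate of at most
    ln (M + 1) / L ([cover_anchored]). Altogether the pressure of pseudo-orbits at
    scale [5 * eps] exceeds the classical one at scale [eps] by an error that tends
    to 0 with [eps] ([PFKPO_eps_le]).

    The second part works with weighted covers ([cover]), which can be restricted,
    united and concatenated ([cover_shift]), and passes to spanning sets only at the
    end ([cover_spanning]). *)

(** * Selecting representatives *)

Section Sums.
Set Implicit Arguments.
Unset Strict Implicit.
Context {R : realType} {I : choiceType}.
Implicit Types (a : I -> R) (s : seq I).

Lemma esum_seq a s : (forall i, 0 <= a i) ->
  (\esum_(i in [set` s]) (a i)%:E <= (\sum_(i <- s) a i)%:E)%E.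
Proof.
move=> a0; rewrite esum_fset; last by move=> i _; rewrite lee_fin.
  have -> : [set` s] = [set` undup s] by apply/seteqP; split=> i /=; rewrite mem_undup.
  rewrite -fsbig_seq ?undup_uniq // sumEFin lee_fin.
  elim: s => [|i s IH] /=; first by rewrite big_nil.
  rewrite big_cons; case: ifP => _; first by apply: (le_trans IH); rewrite lerDr.
  by rewrite big_cons lerD2l.
by apply/finite_seqP; exists s.
Qed.

(** Terms bounded below by [c] leave room for only finitely many of them under a
    finite sum: near-optimal spanning sets are finite. *)
Lemma finite_esum_lty a (F : set I) (c C : R) : 0 < c ->
  (forall i, c <= a i) -> (\esum_(i in F) (a i)%:E < C%:E)%E ->
  exists s : seq I, F = [set` s] /\ \sum_(i <- s) a i <= C.
Proof.
move=> c0 ca FC.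
have sub (s : seq I) : uniq s -> [set` s] `<=` F -> \sum_(i <- s) a i <= C.
  move=> us sF; rewrite -lee_fin; apply: le_trans (ltW FC).
  rewrite -sumEFin fsbig_seq //; apply: esum_ge; by exists [set` s].
have Ffin : finite_set F.
  apply: contrapT => /= infF.
  have [A AF Asize] := infinite_set_fset (Num.truncn (C / c)).+1 infF.
  have := sub _ (finmap.fset_uniq A) AF; apply/negP; rewrite -ltNge.
  apply: (@lt_le_trans _ _ (\sum_(i <- finmap.enum_fset A) c)).
    rewrite big_const_seq count_predT iter_addr_0 -mulr_natr mulrC -ltr_pdivrMr //.
    by apply: lt_le_trans (truncnS_gt _) _; rewrite ler_nat.
  by apply: ler_sum => i _; exact: ca.
have /finite_seqP[s Fs] := Ffin; exists (undup s).
have E : F = [set` undup s].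
  by rewrite Fs; apply/seteqP; split=> i /=; rewrite mem_undup.
by split=> //; apply: sub; rewrite ?undup_uniq // -E.
Qed.

(** Spanning sets consist of points of the set that they span. One point of [Y] in
    each listed set that meets [Y] achieves this, and the hypothesis on the weights
    [U.2] keeps the sum below the total weight. *)
Lemma representatives a (Y : set I) (u : seq (set I * R)) :
  (forall i, 0 <= a i) -> (forall U i, U \in u -> U.1 i -> a i <= U.2) ->
  (forall U, U \in u -> 0 <= U.2) ->
  exists F : set I, [/\ F `<=` Y,
    forall U i, U \in u -> Y i -> U.1 i -> exists2 j, F j & U.1 j &
    (\esum_(i in F) (a i)%:E <= (\sum_(U <- u) U.2)%:E)%E].
Proof.
move=> a0 au u0.
suff [s [sY su sw]] : exists s : seq I, [/\ [set` s] `<=` Y,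
    forall U i, U \in u -> Y i -> U.1 i -> exists2 j, j \in s & U.1 j &
    \sum_(i <- s) a i <= \sum_(U <- u) U.2].
  exists [set` s]; split=> //.
  by apply: le_trans (esum_seq _ a0) _; rewrite lee_fin.
elim: u => [|U u IH] in au u0 *; first by exists [::]; split=> //; rewrite !big_nil.
have [|U' U'u|s [sY su sw]] := IH.
- by move=> U' i U'u; apply: au; rewrite inE U'u orbT.
- by apply: u0; rewrite inE U'u orbT.
have [[i [Yi Ui]]|noU] := pselect (exists i, Y i /\ U.1 i).
  exists (i :: s); split.
  - by move=> j /=; rewrite inE => /orP[/eqP -> //|/sY].
  - move=> V j; rewrite inE => /orP[/eqP ->|Vu] Yj Vj.
      by exists i; rewrite ?inE ?eqxx.
    by have [k ks Vk] := su V j Vu Yj Vj; exists k; rewrite ?inE ?ks ?orbT.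
  - by rewrite !big_cons lerD //; apply: au => //; rewrite inE eqxx.
exists s; split=> //.
  move=> V j; rewrite inE => /orP[/eqP ->|Vu] Yj Vj; last exact: su Vu Yj Vj.
  by case: noU; exists j.
by rewrite big_cons; apply: le_trans sw _; rewrite lerDr u0 ?inE ?eqxx.
Qed.
End Sums.

(** * Weighted covers of sets of sequences *)

Section Covers.
Set Implicit Arguments.
Unset Strict Implicit.
Context {R : realType} {X : metricType R}.
Variables (f : X -> R) (eps : R).
Implicit Types (x y : nat -> X) (Y Z : set (nat -> X)) (C D : R).

Definition shift (a : nat) x : nat -> X := fun i => x (a + i)%N.

Definition birkhoff (n : nat) x : R := \sum_(i < n) f (x i).

Lemma birkhoffD a b x : birkhoff (a + b) x = birkhoff a x + birkhoff b (shift a x).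
Proof. exact: big_split_ord. Qed.

(** The weight of a piece dominates [expR (birkhoff n x)] for all its points, so
    that any choice of one point per piece has total weight at most [C]. The pieces
    may leave [Y], which makes covers, unlike spanning sets, behave well under
    inclusion, union and concatenation. *)
Definition cover n Y C := exists u : seq (set (nat -> X) * R),
  [/\ forall x, Y x -> exists2 U, U \in u & U.1 x,
      forall U, U \in u -> [/\ 0 <= U.2,
        forall x, U.1 x -> expR (birkhoff n x) <= U.2 &
        forall x y, U.1 x -> U.1 y -> forall i, (i < n)%N -> mdist (x i) (y i) < eps] &
      \sum_(U <- u) U.2 <= C].

Lemma cover_ge0 n Y C : cover n Y C -> 0 <= C.
Proof.
case=> u [_ u0]; apply: le_trans; rewrite big_seq.
by apply: sumr_ge0 => U /u0[].
Qed.

Lemma cover_le n Y C D : cover n Y C -> C <= D -> cover n Y D.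
Proof. by move=> [u [uY u0 uC]] CD; exists u; split=> //; exact: le_trans CD. Qed.

Lemma cover_sub n Y Z C : cover n Y C -> Z `<=` Y -> cover n Z C.
Proof. by move=> [u [uY u0 uC]] ZY; exists u; split=> // x /ZY /uY. Qed.

Lemma cover_small n Y C : 0 <= C ->
  (forall x, Y x -> expR (birkhoff n x) <= C) ->
  (forall x y, Y x -> Y y -> forall i, (i < n)%N -> mdist (x i) (y i) < eps) ->
  cover n Y C.
Proof.
move=> C0 YC Yeps; exists [:: (Y, C)]; split.
- by move=> x Yx; exists (Y, C); rewrite ?inE.
- by move=> U; rewrite inE => /eqP ->.
- by rewrite big_seq1.
Qed.

Lemma cover_bigcup (I : eqType) (s : seq I) n (Y : I -> set (nat -> X)) (C : I -> R) :
  (forall i, i \in s -> cover n (Y i) (C i)) ->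
  cover n [set x | exists2 i, i \in s & Y i x] (\sum_(i <- s) C i).
Proof.
elim: s => [|i s IH] sC; first by exists [::]; split=> [x []//|//|]; rewrite !big_nil.
have [|v [vY v0 vC]] := IH; first by move=> j js; apply: sC; rewrite inE js orbT.
have [|u [uY u0 uC]] := sC i; first by rewrite inE eqxx.
exists (u ++ v); split.
- move=> x [j]; rewrite inE => /orP[/eqP -> /uY[U Uu Ux]|js Yx].
    by exists U; rewrite // mem_cat Uu.
  by have [|U Uv Ux] := vY x; [exists j|exists U; rewrite // mem_cat Uv orbT].
- by move=> U; rewrite mem_cat => /orP[/u0|/v0].
- by rewrite big_cat big_cons lerD.
Qed.

(** Submultiplicativity: a piece for the first [a] letters and a piece for the next
    [b] letters combine into one for the whole word. *)
Lemma cover_shift a b Y Z C D : cover a Y C -> cover b Z D ->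
  cover (a + b) [set x | Y x /\ Z (shift a x)] (C * D).
Proof.
move=> [u [uY u0 uC]] [v [vZ v0 vD]].
pose UV (U V : set (nat -> X) * R) := ([set x | U.1 x /\ V.1 (shift a x)], U.2 * V.2).
exists [seq UV U V | U <- u, V <- v]; split.
- move=> x [/uY[U Uu Ux] /vZ[V Vv Vx]].
  by exists (UV U V); rewrite // allpairs_f.
- move=> _ /allpairsP[[U V] /= [/u0[U0 UC Ueps] /v0[V0 VC Veps] ->]] /=; split.
  + exact: mulr_ge0.
  + move=> x [Ux Vx]; rewrite birkhoffD expRD.
    by apply: ler_pM; rewrite ?expR_ge0 ?UC ?VC.
  + move=> x y [Ux Vx] [Uy Vy] i iab; have [ia|ai] := ltnP i a; first exact: Ueps.
    have := Veps _ _ Vx Vy (i - a)%N; rewrite /shift subnKC //; apply.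
    by rewrite ltn_subLR.
- rewrite big_allpairs_dep /=; under eq_bigr do rewrite -mulr_sumr.
  rewrite -mulr_suml; apply: ler_pM => //; rewrite big_seq sumr_ge0 // => W.
    by move=> /u0[].
  by move=> /v0[].
Qed.

(** Points of the same piece are [eps]-close, so one representative of each piece
    that meets [Y] is enough. *)
Lemma cover_spanning n Y C : cover n Y C -> exists2 F, seq_spanning Y n eps F &
  (\esum_(x in F) (expR (birkhoff n x))%:E <= C%:E)%E.
Proof.
move=> [u [uY u0 uC]].
have [||| F [FY FU FC]] := @representatives _ _ (fun x => expR (birkhoff n x)) Y u.
- by move=> x; exact: expR_ge0.
- by move=> U x /u0[_ UC _]; exact: UC.
- by move=> U /u0[].
exists F; last by apply: le_trans FC _; rewrite lee_fin.
split=> // x Yx; have [U Uu Ux] := uY x Yx; have [y Fy Uy] := FU U x Uu Yx Ux.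
by exists y => // i; have [_ _ Ueps] := u0 U Uu; exact: Ueps.
Qed.

End Covers.

(** * Uniform continuity, nets and tracing *)

Section Compactness.
Set Implicit Arguments.
Unset Strict Implicit.
Context {R : realType} {X : metricType R}.
Hypothesis compactX : compact [set: X].

Lemma mdist_ball (x y : X) (r : R) : ball x r y = (mdist x y < r) :> Prop.
Proof. by rewrite ballEmdist. Qed.

Lemma compact_unif_continuous (Y : pseudoMetricType R) (g : X -> Y) (e : R) :
  continuous g -> 0 < e ->
  exists2 d : R, 0 < d & forall x y, mdist x y <= d -> ball (g x) e (g y).
Proof.
move=> cg e0; have /compact_near_coveringP := compactX.
move=> /(_ R (0^'+) (fun d x => forall y, mdist x y <= d -> ball (g x) e (g y)) _).
case.
  move=> x _; have /nbhs_ballP[r /= r0 rg] : nbhs x (g @^-1` ball (g x) (e / 2)).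
    by apply: cg; apply: nbhsx_ballx; rewrite divr_gt0.
  exists (ball x (r / 2), [set d | d < r / 2]); first split => /=.
  - by apply: nbhsx_ballx; rewrite divr_gt0.
  - by apply: nbhs_right_lt; rewrite divr_gt0.
  case=> z d /= [xz dr] y zy; apply: (@ball_splitr _ _ (g x)).
    apply: rg; rewrite !mdist_ball in xz *.
    by apply: lt_trans xz _; rewrite ltr_pdivrMr // ltr_pMr // ltr1n.
  apply: rg; rewrite !mdist_ball in xz *; apply: le_lt_trans (metric_triangle _ z _) _.
  by rewrite [ltRHS]splitr ltrD // (le_lt_trans zy).
move=> r /= r0 rP; exists (r / 2); first by rewrite divr_gt0.
move=> x y; apply: (rP (r / 2)) => //=; last by rewrite divr_gt0.
by rewrite sub0r normrN gtr0_norm ?divr_gt0 // ltr_pdivrMr // ltr_pMr // ltr1n.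
Qed.

Lemma compact_net (e : R) : 0 < e ->
  exists m (net : 'I_m -> X), forall x, exists p, mdist x (net p) <= e.
Proof.
move=> e0; have /compact_near_coveringP := compactX.
(* finite lists, filtered by inclusion: a list that works near each point
   upgrades to one that works everywhere *)
pose F : set_system (seq X) :=
  [set A | exists s0 : seq X, forall s : seq X, {subset s0 <= s} -> A s].
have FF : Filter F.
  split.
  - by exists [::].
  - move=> P Q [s sP] [t tQ]; exists (s ++ t) => w sub; split.
      by apply: sP => x xs; apply: sub; rewrite mem_cat xs.
    by apply: tQ => x xs; apply: sub; rewrite mem_cat xs orbT.
  - by move=> P Q PQ [s sP]; exists s => w /sP /PQ.
move=> /(_ _ F (fun (s : seq X) x => exists2 y, y \in s & mdist x y <= e) FF).
case.
  move=> x _; exists (ball x e, [set s : seq X | x \in s]); first split => /=.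
  - exact: nbhsx_ballx.
  - by exists [:: x] => s; apply; rewrite inE.
  by case=> z s /= [xz xs]; exists x => //; rewrite mdist_ball in xz; rewrite metric_sym ltW.
move=> s /(_ s (fun _ h => h)) sP; exists (size s), (tnth (in_tuple s)) => x.
have [y /seq_tnthP[p ->] xy] := sP x I.
by exists p.
Qed.

Lemma compact_bounded_fun (f : X -> R) : continuous f ->
  exists2 B : R, 0 <= B & forall x, `|f x| <= B.
Proof.
move=> cf; have [d d0 df] := compact_unif_continuous cf ltr01.
have [m [net netP]] := compact_net d0.
exists (\sum_p (`|f (net p)| + 1)); first by apply: sumr_ge0 => p _; rewrite addr_ge0.
move=> x; have [p xp] := netP x; rewrite (bigD1 p) //= ler_wpDr //.
  by apply: sumr_ge0 => q _; rewrite addr_ge0.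
have := df _ _ xp; rewrite -ball_normE /= => /ltW fp.
by rewrite -lerBlDl; apply: le_trans fp; exact: lerB_dist.
Qed.

Variables (T : X -> X) (contT : continuous T).

Lemma unif_continuous_iter K (e : R) : 0 < e -> exists2 d : R, 0 < d &
  forall x y g, (g <= K)%N -> mdist x y <= d -> mdist (iter g T x) (iter g T y) <= e.
Proof.
elim: K => [|K IH] in e *; move=> e0.
  by exists e => // x y [].
have [d d0 dT] := compact_unif_continuous contT e0.
have de : 0 < Num.min d e by rewrite lt_min d0.
have [d' d'0 dK] := IH _ de.
exists (Num.min d' e); rewrite ?lt_min ?d'0 // => x y [_|g gK].
  by rewrite le_min => /andP[].
rewrite le_min => /andP[xy _].
have := dK x y g gK xy; rewrite le_min => /andP[/dT + _].
by rewrite mdist_ball => /ltW.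
Qed.

(** The points [z t] stand for the successive matched letters of a pseudo-chain, and
    the clock [j t] for the times with which they are matched. *)
Definition traces (alpha : R) (K : nat) (e : R) :=
  forall m (z : nat -> X) (j : nat -> nat), (m <= K)%N ->
    (forall t, (t <= m)%N -> (j 0 <= j t <= K)%N) ->
    (forall t, (t < m)%N -> (j t <= j t.+1)%N) ->
    (forall t, (t < m)%N -> mdist (iter (j t.+1 - j t) T (z t)) (z t.+1) <= alpha) ->
    mdist (iter (j m - j 0) T (z 0)) (z m) <= e.

(** There are at most [K] jumps, and each of them applies an iterate of [T] of order
    at most [K] to the error made so far; so [alpha] is found by going backwards
    [K] times through the uniform continuity of these iterates. *)
Lemma traces_exists K (e : R) : 0 < e -> exists2 alpha : R, 0 < alpha & traces alpha K e.
Proof.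
rewrite /traces; move: {1}K => n; elim: n => [|n IH] in e *; move=> e0.
  exists 1 => // m z j; rewrite leqn0 => /eqP -> _ _ _.
  by rewrite subnn mdistxx ltW.
have e2 : 0 < e / 2 by rewrite divr_gt0.
have [d d0 dK] := unif_continuous_iter K e2.
have de : 0 < Num.min d e by rewrite lt_min d0.
have [a a0 aP] := IH _ de.
exists (Num.min a (e / 2)); first by rewrite lt_min a0.
move=> m z j; rewrite leq_eqVlt => /orP[/eqP -> {m} jK jS zj|mn jK jS zj]; last first.
  have : mdist (iter (j m - j 0) T (z 0)) (z m) <= Num.min d e.
    by apply: aP => // t /zj; rewrite le_min => /andP[].
  by rewrite le_min => /andP[].
have : mdist (iter (j n - j 0) T (z 0)) (z n) <= Num.min d e.
  apply: aP => // t tn; [exact/jK/leqW|exact/jS/leqW|].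
  by have := zj t (leqW tn); rewrite le_min => /andP[].
rewrite le_min => /andP[zn _].
have [jn jnK] := andP (jK n (leqnSn n)); have [_ jnSK] := andP (jK n.+1 (leqnn _)).
have jnn := jS n (leqnn _).
rewrite -(subnK jnn) -addnBA // iterD; apply: le_trans (metric_triangle _ (iter (j n.+1 - j n) T (z n)) _) _.
rewrite [leRHS]splitr lerD //; first by apply: dK => //; rewrite leq_subLR (leq_trans jnSK) // leq_addl.
by have := zj n (leqnn _); rewrite le_min => /andP[].
Qed.

End Compactness.

(** * Increasing matchings and pseudo-chains *)

Section Matchings.
Set Implicit Arguments.
Unset Strict Implicit.

Lemma increasing_inj l (I : {set 'I_l}) (g : 'I_l -> 'I_l) :
  {in I &, {homo g : a b / (a < b)%N}} -> {in I &, injective g}.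
Proof.
move=> gi a b aI bI gab; apply/val_inj/eqP.
by case: ltngtP => // ab; [have := gi _ _ aI bI ab|have := gi _ _ bI aI ab]; rewrite gab ltnn.
Qed.

(** Both maps send the r-th element of [I] to the r-th element of the image. *)
Lemma increasing_imset_inj l (I : {set 'I_l}) (g h : 'I_l -> 'I_l) :
  {in I &, {homo g : a b / (a < b)%N}} -> {in I &, {homo h : a b / (a < b)%N}} ->
  g @: I = h @: I -> {in I, g =1 h}.
Proof.
(* the rank of u a in the image is the rank of a in I *)
have rank (u : 'I_l -> 'I_l) a : {in I &, {homo u : a b / (a < b)%N}} -> a \in I ->
    #|[set j in u @: I | (j < u a)%N]| = #|[set b in I | (b < a)%N]|.
  move=> ui aI; rewrite -[RHS](@card_in_imset _ _ u); last first.
    move=> b c; rewrite !inE => /andP[bI _] /andP[cI _]; exact: (increasing_inj ui bI cI).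
  apply: eq_card => j; rewrite !inE; apply/andP/imsetP.
    case=> /imsetP[b bI ->] uba; exists b => //; rewrite !inE bI /=.
    case: ltngtP => // [ab|/val_inj E]; last by move: uba; rewrite E ltnn.
    by have := ui _ _ aI bI ab; rewrite ltnNge ltnW.
  by case=> b; rewrite !inE => /andP[bI ba] ->; rewrite imset_f //; split=> //; exact: ui.
have lt (u v : 'I_l -> 'I_l) a : {in I &, {homo u : a b / (a < b)%N}} ->
    {in I &, {homo v : a b / (a < b)%N}} -> u @: I = v @: I -> a \in I ->
    ~~ (u a < v a)%N.
  move=> ui vi uv aI; apply/negP => uva.
  have : #|[set j in u @: I | (j < u a)%N]| = #|[set j in u @: I | (j < v a)%N]|.
    by rewrite (rank u) // uv (rank v).
  apply/eqP; rewrite neq_ltn; apply/orP; left; apply: proper_card; apply/fintype.properP; split.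
    by apply/fintype.subsetP => j; rewrite !inE => /andP[-> /ltn_trans]; apply.
  by exists (u a); rewrite !inE ?imset_f ?uva ?ltnn.
move=> gi hi gh a aI; apply/val_inj/eqP.
by rewrite eqn_leq leqNgt lt //= leqNgt lt.
Qed.

Lemma sum_incl (R : realType) n (h : nat -> R) (J : {set 'I_n}) :
  (forall i, 0 <= h i) -> \sum_(j in J) h j <= \sum_(j < n) h j.
Proof.
move=> h0; rewrite [leRHS](bigID (mem J)) /= lerDl; exact: sumr_ge0.
Qed.
End Matchings.

Section Window.
Set Implicit Arguments.
Unset Strict Implicit.
Context {R : realType} {X : metricType R}.
Variables (T : X -> X) (f : X -> R) (B gam eps delta : R) (l m : nat) (net : 'I_m -> X).
Local Notation code := {ffun 'I_l -> option 'I_m * bool}.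
Implicit Types (e : X) (x : nat -> X) (c : code).

(** A code has one letter per position a of the window. Its first component is
    [None] when the letter at a is matched, and otherwise names a net point close to
    it. Its second component tells whether a is one of the matched times, counted
    from the first one. *)
Definition kept c : {set 'I_l} := [set a | (c a).1 == None].
Definition used c : {set 'I_l} := [set a | (c a).2].

Definition center e c (g : 'I_l -> 'I_l) a : X :=
  if (c a).1 is Some p then net p else iter (g a) T e.

(** The matching [g] is not part of the code: its domain [kept c] and its range
    [used c] determine it. So a matching costs no more than a pair of large subsets. *)
Definition window e c : set (nat -> X) :=
  [set x | (1 - delta) * l%:R < #|kept c|%:R /\
    exists g : 'I_l -> 'I_l,
    [/\ {in kept c &, {homo g : a b / (a < b)%N}}, g @: kept c = used c &
      forall a, mdist (x a) (center e c g a) <= 2 * eps]].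

Hypothesis f_bound : forall p, `|f p| <= B.
Hypothesis f_unif : forall p q, mdist p q <= 2 * eps -> f p - f q <= gam.
Hypothesis eps_gt0 : 0 < eps.
Hypothesis gam_ge0 : 0 <= gam.

Lemma window_close e c x y : window e c x -> window e c y ->
  forall i, (i < l)%N -> mdist (x i) (y i) < 5 * eps.
Proof.
move=> [_ [g [gi gJ gx]]] [_ [h [hi hJ hy]]] i il.
have gh := increasing_imset_inj gi hi (etrans gJ (esym hJ)).
pose a := Ordinal il; have := gx a; have := hy a.
have -> : center e c h a = center e c g a.
  rewrite /center; case E : (c a).1 => [//|]; rewrite gh // inE E eqxx //.
move=> ya xa; apply: le_lt_trans (metric_triangle _ (center e c g a) _) _.
rewrite (metric_sym (center _ _ _ _)).
have {}xa : mdist (x i) (center e c g a) <= 2 * eps := xa.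
have {}ya : mdist (y i) (center e c g a) <= 2 * eps := ya.
have e0 := eps_gt0; lra.
Qed.

(** The matched letters pick, injectively, terms of the Birkhoff sum of [e] up to
    [gam]; the fewer than [delta * l] unmatched letters, and the equally many terms
    that are not picked, cost at most [B] each. *)
Lemma window_birkhoff e c x : 0 <= B -> window e c x ->
  birkhoff f l x <= birkhoff f l (fun i => iter i T e) + l%:R * (gam + 2 * B * delta).
Proof.
move=> B0 [kd [g [gi gJ gx]]]; rewrite /birkhoff.
have gk := increasing_inj gi.
(* B - f and f + B are nonnegative, so that their partial sums can be compared
   with the full sums *)
have h1 : \sum_(a in kept c) (B - f (x a)) <= \sum_(a < l) (B - f (x a)).
  apply: (@sum_incl R l (fun i => B - f (x i))) => i.
  by rewrite subr_ge0 (le_trans (ler_norm _)).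
have h2 : \sum_(a in kept c) (f (iter (g a) T e) + B) <= \sum_(a < l) (f (iter a T e) + B).
  rewrite -(big_imset (fun j : 'I_l => f (iter j T e) + B)) //=.
  apply: (@sum_incl R l (fun i => f (iter i T e) + B)) => i.
  by have := f_bound (iter i T e); rewrite ler_norml => /andP[fb _]; lra.
have h3 : \sum_(a in kept c) (f (x a) - f (iter (g a) T e)) <= \sum_(a in kept c) gam.
  apply: ler_sum => a; rewrite inE => /eqP E; apply: f_unif.
  by have := gx a; rewrite /center E.
rewrite !sumrB !big_split /= !sumr_const !card_ord in h1 h2 h3.
rewrite -?[B *+ _]mulr_natr -?[gam *+ _]mulr_natr in h1 h2 h3.
have kl : #|kept c|%:R <= l%:R :> R by rewrite ler_nat -[X in (_ <= X)%N]card_ord max_card.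
set k : R := #|kept c|%:R in kd h1 h2 h3 kl.
have h4 : gam * k <= gam * l%:R by rewrite ler_wpM2l.
have h5 : B * ((1 - delta) * l%:R) <= B * k by rewrite ler_wpM2l // ltW.
lra.
Qed.

(** Generating function of the codes, by distributivity: weighting each unmatched
    letter by [q] replaces binomial estimates for the number of matchings. *)
Lemma sumc_window (q : R) :
  \sum_(c : code) \prod_a (q ^+ ((c a).1 != None) * q ^+ (~~ (c a).2)) =
  (\sum_(d : option 'I_m * bool) q ^+ (d.1 != None) * q ^+ (~~ d.2)) ^+ l.
Proof.
transitivity (\prod_(a < l) \sum_(d : option 'I_m * bool) q ^+ (d.1 != None) * q ^+ (~~ d.2)).
  by rewrite bigA_distr_bigA.
by rewrite prodr_const card_ord.
Qed.

Lemma sum_letters (q : R) : 0 <= q <= 1 ->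
  \sum_(d : option 'I_m * bool) q ^+ (d.1 != None) * q ^+ (~~ d.2) <=
  1 + q *+ (m.+1 * 2).
Proof.
move=> /andP[q0 q1]; rewrite (bigD1 (None, true)) //= mulr1 expr0 lerD2l.
apply: le_trans (_ : \sum_(d : option 'I_m * bool) q <= _); last first.
  by rewrite sumr_const card_prod card_option card_ord card_bool.
rewrite [leRHS](bigD1 (None, true)) //= ler_wpDl //; apply: ler_sum => -[w b] /=.
case: w => [p|]; case: b => //= _; rewrite ?expr1 ?expr0 ?mulr1 ?mul1r //.
by rewrite -[leRHS]mulr1 ler_wpM2l.
Qed.

(** Range and domain of a matching have the same size, hence the factor 2. *)
Lemma prod_letters (q : R) c e x : window e c x ->
  \prod_a (q ^+ ((c a).1 != None) * q ^+ (~~ (c a).2)) = q ^+ ((l - #|kept c|) * 2).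
Proof.
move=> [_ [g [gi gJ gx]]].
have sumC (A : {set 'I_l}) : (\sum_(a < l) (a \notin A) = l - #|A|)%N.
  have E : (#|A| + #|[predC A]| = l)%N by rewrite cardC card_ord.
  transitivity #|[predC A]|; last by lia.
  rewrite -sum1_card [RHS]big_mkcond.
  by apply: eq_bigr => a _; rewrite inE /=; case: (a \in A).
rewrite big_split /= !prodrXr mulnC mul2n -addnn exprD -{1}sumC.
have -> : #|kept c| = #|used c| by rewrite -gJ card_in_imset //; exact: increasing_inj gi.
rewrite -sumC; congr (q ^+ _ * q ^+ _); apply: eq_bigr => a _; by rewrite inE.
Qed.

(** The term [2 * kappa * delta] compensates the factors [expR (- kappa)], of which
    there are at most [2 * delta * l]. *)
Definition window_weight (kappa : R) e c : R :=
  expR (birkhoff f l (fun i => iter i T e) + l%:R * (gam + 2 * B * delta + 2 * kappa * delta)) *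
  \prod_a (expR (- kappa) ^+ ((c a).1 != None) * expR (- kappa) ^+ (~~ (c a).2)).

Lemma cover_window (kappa : R) e c : 0 <= B -> 0 <= kappa ->
  cover f (5 * eps) l (window e c) (window_weight kappa e c).
Proof.
move=> B0 k0; apply: cover_small.
- by rewrite mulr_ge0 ?expR_ge0 // prodr_ge0 // => a _; rewrite mulr_ge0 // exprn_ge0 // expR_ge0.
- move=> x wx; rewrite /window_weight (prod_letters _ wx) -expRM_natl -expRD ler_expR.
  apply: le_trans (window_birkhoff B0 wx) _; rewrite -addrA lerD2l.
  have [kd _] := wx.
  have kl : (#|kept c| <= l)%N by rewrite -[X in (_ <= X)%N]card_ord max_card.
  rewrite natrM natrB //; set k : R := #|kept c|%:R in kd *.
  have h5 : kappa * ((1 - delta) * l%:R) <= kappa * k by rewrite ler_wpM2l // ltW.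
  lra.
- by move=> x y; exact: window_close.
Qed.

Lemma sum_window_weight (kappa : R) (s : seq X) : 0 <= kappa ->
  \sum_(e <- s) \sum_(c : code) window_weight kappa e c <=
  (\sum_(e <- s) expR (birkhoff f l (fun i => iter i T e))) *
  expR (l%:R * (gam + 2 * B * delta + 2 * kappa * delta + expR (- kappa) *+ (m.+1 * 2))).
Proof.
move=> k0; have q0 := expR_ge0 (- kappa).
have q1 : expR (- kappa) <= 1 by rewrite -expR0 ler_expR oppr_le0.
rewrite mulr_suml; apply: ler_sum => e _; rewrite -mulr_sumr sumc_window.
set q := expR (- kappa) in q0 q1 *.
rewrite -expRD [X in _ <= expR (_ + X)]mulrDr addrA [leRHS]expRD.
apply: ler_wpM2l; first exact: expR_ge0.
rewrite expRM_natl; apply: lerXn2r; rewrite ?nnegrE ?expR_ge0 //.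
  by apply: sumr_ge0 => d _; rewrite mulr_ge0 // exprn_ge0.
by apply: le_trans (sum_letters _) (expR_ge1Dx _); rewrite q0.
Qed.

Hypothesis net_dense : forall p, exists a, mdist p (net a) <= eps.

(** The orbit of the first matched letter is traced by the other ones; [e] is a
    point of the spanning set close to that letter. *)
Lemma chain_window (alpha : R) (s : seq X) x : traces T alpha l eps ->
  (forall p, exists2 e, e \in s & bowen_dist T l p e <= eps) ->
  FK_pseudo_chain T alpha delta (fun a : 'I_l => x a) ->
  exists2 e, e \in s & exists c, window e c x.
Proof.
move=> tr sP [[|k] [/andP[// _ kl] dk [i [j [ii jj ij]]]]].
have imono (a b : 'I_k.+1) : (a <= b)%N -> (i a <= i b)%N.
  by rewrite leq_eqVlt => /orP[/eqP/val_inj ->//|/ii/ltnW].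
have jmono (a b : 'I_k.+1) : (a <= b)%N -> (j a <= j b)%N.
  by rewrite leq_eqVlt => /orP[/eqP/val_inj ->//|/jj/ltnW].
have iinj : injective i.
  by move=> a b iab; apply/val_inj/eqP; case: ltngtP => // /ii; rewrite iab ltnn.
have ilt a b : (i a < i b)%N -> (a < b)%N.
  by apply: contraTltn => ba; rewrite -leqNgt imono.
have [e es ze] := sP (x (i ord0)); exists e => //.
have jl (t : 'I_k.+1) : (j t - j ord0 < l)%N by rewrite (leq_ltn_trans (leq_subr _ _)).
(* positions outside the range of i are unmatched; they keep the default value *)
pose g a := if [pick t | i t == a] is Some t then Ordinal (jl t) else a.
have gi t : g (i t) = Ordinal (jl t).
  rewrite /g; case: pickP => [u /eqP/iinj -> //|/(_ t)]; by rewrite eqxx.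
pose nu p := projT1 (cid (net_dense p)).
have nuP p : mdist p (net (nu p)) <= eps by rewrite /nu; case: cid.
pose K := [set i t | t in 'I_k.+1]%SET.
pose c := [ffun a => (if a \in K then None else Some (nu (x a)), a \in [set g b | b in K]%SET)].
have keptc : kept c = K by apply/setP => a; rewrite inE ffunE; case: ifP.
exists c; split.
  by rewrite keptc card_imset // card_ord.
exists g; split.
- move=> a b; rewrite keptc => /imsetP[t _ ->] /imsetP[u _ ->] /ilt tu.
  by rewrite !gi /=; apply: ltn_sub2r (jj _ _ tu); apply: leq_ltn_trans (jj _ _ tu); exact: jmono.
- by rewrite keptc; apply/setP => a; rewrite !inE ffunE.
move=> a; rewrite /center ffunE /=; case: ifP => [/imsetP[t _ ->]|_]; last first.
  by apply: le_trans (nuP _) _; have e0 := eps_gt0; lra.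
rewrite gi /= mulr_natl mulr2n.
have := tr t (fun u => x (i (inord u))) (fun u => j (inord u)).
have -> : inord 0 = ord0 :> 'I_k.+1 by apply/val_inj; rewrite /= inordK.
rewrite inord_val => trt.
apply: le_trans (metric_triangle _ (iter (j t - j ord0) T (x (i ord0))) _) _.
apply: lerD.
  rewrite metric_sym; apply: trt.
  - exact: leq_trans (ltnW (ltn_ord t)) kl.
  - by move=> u ut; rewrite jmono //= ltnW.
  - move=> u ut; have uk : (u.+1 < k.+1)%N := leq_ltn_trans ut (ltn_ord t).
    by apply: jmono; rewrite inordK ?inordK ?(ltnW uk).
  - move=> u ut; have uk : (u.+1 < k.+1)%N := leq_ltn_trans ut (ltn_ord t).
    by apply: ij; rewrite !inordK // (ltnW uk).
apply: le_trans ze.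
by rewrite /bowen_dist; apply: (le_bigmax _ (fun b : 'I_l => mdist (iter b T (x (i ord0))) (iter b T e)) (Ordinal (jl t))).
Qed.

(** Pseudo-chains of length [l] cost no more than an (l, eps)-spanning set of
    orbits, up to a factor whose rate is small when [gam], [delta] and [1 / kappa]
    are, in the order [gam], [kappa], [delta]. *)
Lemma cover_chains (alpha kappa : R) (s : seq X) : 0 <= B -> 0 <= kappa ->
  traces T alpha l eps ->
  (forall p, exists2 e, e \in s & bowen_dist T l p e <= eps) ->
  cover f (5 * eps) l [set x | FK_pseudo_chain T alpha delta (fun a : 'I_l => x a)]
    ((\sum_(e <- s) expR (birkhoff f l (fun i => iter i T e))) *
     expR (l%:R * (gam + 2 * B * delta + 2 * kappa * delta + expR (- kappa) *+ (m.+1 * 2)))).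
Proof.
move=> B0 k0 tr sP; apply: cover_le (sum_window_weight s k0).
have H : cover f (5 * eps) l
   [set x | exists2 e, e \in s & exists2 c, c \in index_enum code & window e c x]
   (\sum_(e <- s) \sum_(c : code) window_weight kappa e c).
  apply: cover_bigcup => e _; apply: cover_bigcup => c _; exact: cover_window.
apply: cover_sub H _ => x /= /(chain_window tr sP)[e es [c wc]].
by exists e => //; exists c; rewrite ?mem_index_enum.
Qed.

End Window.

(** * Concatenating windows *)

Section Concatenation.
Set Implicit Arguments.
Unset Strict Implicit.
Context {R : realType} {X : metricType R}.
Variables (T : X -> X) (f : X -> R) (alpha delta eps : R) (M : nat).
Implicit Types (x : nat -> X).

Definition chain (l : nat) : set (nat -> X) :=
  [set x | FK_pseudo_chain T alpha delta (fun a : 'I_l => x a)].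

Definition cuts x (s : nat -> nat) :=
  [/\ {homo s : a b / (a < b)%N}, forall i, (s i.+1 - s i <= M)%N &
      forall n p, (n < p)%N -> chain (s p - s n) (shift (s n) x)].

(** Pseudo-orbits whose first cut is at 0: unlike pseudo-orbits in general, they
    split into a pseudo-chain followed by a sequence of the same kind. *)
Definition anchored : set (nat -> X) := [set x | exists2 s, s 0 = 0 & cuts x s].

Lemma anchored_shift x s p : cuts x s -> anchored (shift (s p) x).
Proof.
move=> [si sM sc]; exists (fun i => s (p + i) - s p)%N; first by rewrite addn0 subnn.
have sp i : (s p <= s (p + i))%N.
  by case: i => [|i]; rewrite ?addn0 // ltnW // si // -addSnnS ltn_addr.
split.
- by move=> a b ab; apply: ltn_sub2r; [apply: leq_ltn_trans (sp a) _|]; apply: si; rewrite ltn_add2l.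
- by move=> i; rewrite subnBA // subnK // addnS.
- move=> a b ab; rewrite subnBA // subnK //.
  have -> : shift (s (p + a) - s p) (shift (s p) x) = shift (s (p + a)%N) x.
    by apply/funext => i; rewrite /shift addnA subnKC.
  by apply: sc; rewrite ltn_add2l.
Qed.

Lemma pseudo_orbit_anchored x : FK_pseudo_orbit T alpha delta M x ->
  exists2 a, (a <= M)%N & anchored (shift a x).
Proof.
by move=> [s [si s0 sM sc]]; exists (s 0) => //; exact: anchored_shift.
Qed.

(** Cut at the first [s p] that is at least [L]; it overshoots by less than [M]. *)
Lemma anchored_split L x : (0 < L)%N -> anchored x ->
  exists2 l, (L <= l < L + M.+1)%N & chain l x /\ anchored (shift l x).
Proof.
move=> L0 [s s0 cs]; have [si sM sc] := cs.
have sge i : (i <= s i)%N by elim: i => // i IH; apply: leq_ltn_trans IH (si _ _ _).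
have ex : exists p, (L <= s p)%N by exists L.
have [p Lp pmin] := ex_minnP ex; exists (s p); last first.
  split; last exact: anchored_shift.
  have p0 : (0 < p)%N by case: p Lp {pmin} => //; rewrite s0 leqNgt L0.
  by have := sc _ _ p0; rewrite s0 subn0.
rewrite Lp /=; case: p => [|p] in Lp pmin *; first by rewrite s0 addnS.
have sp : (s p < L)%N by rewrite ltnNge; apply/negP => /pmin; rewrite ltnn.
by have := sM p; have := si p p.+1 (ltnSn p); lia.
Qed.

(** Induction on [n], removing a first window of length l; the factor [M.+1] in the
    bound on [Q] pays for the choice of l. *)
Lemma cover_anchored (L : nat) (Q : nat -> R) (A beta : R) : (0 < L)%N ->
  (forall l, (L <= l < L + M.+1)%N -> cover f eps l (chain l) (Q l)) ->
  (forall l, (L <= l < L + M.+1)%N -> Q l * M.+1%:R <= expR (l%:R * beta)) ->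
  (forall n, (n <= L + M)%N -> cover f eps n setT (A * expR (n%:R * beta))) ->
  forall n, cover f eps n anchored (A * expR (n%:R * beta)).
Proof.
move=> L0 Qc Qb base n; have [k] := ubnP n; elim: k n => // k IH n nk.
have [nLM|LMn] := leqP n (L + M); first by apply: cover_sub (base n nLM) _.
have A0 : 0 <= A by have := cover_ge0 (base 0 isT); rewrite mul0r expR0 mulr1.
have H : cover f eps n
   [set x | exists2 l, l \in iota L M.+1 & chain l x /\ anchored (shift l x)]
   (\sum_(l <- iota L M.+1) Q l * (A * expR ((n - l)%:R * beta))).
  apply: cover_bigcup => l; rewrite mem_iota => lL.
  have ln : (l <= n)%N by lia.
  rewrite -{1}(subnKC ln); apply: cover_shift; first exact: Qc.
  by apply: IH; lia.
apply: cover_sub (cover_le H _) _; last first.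
  by move=> x /(anchored_split L0)[l lL lx]; exists l; rewrite ?mem_iota.
rewrite big_seq; apply: le_trans (_ : \sum_(l <- iota L M.+1 | l \in iota L M.+1)
    (A * expR (n%:R * beta)) / M.+1%:R <= _).
  apply: ler_sum => l; rewrite mem_iota => lL.
  have ln : (l <= n)%N by lia.
  rewrite ler_pdivlMr ?ltr0n // mulrAC mulrCA; apply: ler_wpM2l => //.
  rewrite -{2}(subnKC ln) natrD mulrDl expRD; apply: ler_wpM2r; rewrite ?expR_ge0 //.
  exact: Qb.
by rewrite -big_seq big_const_seq count_predT size_iota iter_addr_0 -[leLHS]mulr_natr divfK ?pnatr_eq0.
Qed.

End Concatenation.

Section PseudoOrbits.
Set Implicit Arguments.
Unset Strict Implicit.
Context {R : realType} {X : metricType R}.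
Variables (T : X -> X) (f : X -> R) (B eps : R) (m : nat) (net : 'I_m -> X).

Lemma cover_all n : 0 < eps -> (forall p, f p <= B) ->
  (forall p, exists a, mdist p (net a) <= eps) ->
  cover f (5 * eps) n setT ((m%:R * expR B) ^+ n).
Proof.
move=> e0 fB dense; elim: n => [|n IH].
  by apply: cover_small => // x _; rewrite /birkhoff big_ord0 expR0.
have c1 : cover f (5 * eps) 1 setT (m%:R * expR B).
  have -> : m%:R * expR B = \sum_(p < m) expR B by rewrite sumr_const card_ord mulr_natl.
  have H : cover f (5 * eps) 1
      [set x | exists2 p, p \in index_enum 'I_m & mdist (x 0) (net p) <= eps]
      (\sum_(p < m) expR B).
    apply: (@cover_bigcup R X f _ _ _ _ (fun p => [set x | mdist (x 0) (net p) <= eps])) => p _.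
    apply: cover_small; first exact: expR_ge0.
      by move=> x _; rewrite /birkhoff big_ord1 ler_expR.
    move=> x y /= xp yp [] // _; apply: le_lt_trans (metric_triangle _ (net p) _) _.
    by rewrite (metric_sym (net p)); apply: le_lt_trans (lerD xp yp) _; lra.
  by apply: cover_sub H _ => x _; have [p xp] := dense (x 0); exists p; rewrite ?mem_index_enum.
rewrite exprS; apply: cover_sub (cover_shift c1 IH) _ => x _ //.
Qed.

(** The letters before the first cut are covered by brute force; they and the
    short words only affect the constant [C], which may depend on [delta] and [L]
    but not on [n]. *)
Lemma cover_FKPO (N : R -> nat) (alpha delta beta : R) (L : nat) (Q : nat -> R) :
  0 < eps -> (forall p, f p <= B) ->
  (forall p, exists a, mdist p (net a) <= eps) -> (0 < L)%N ->
  (forall l, (L <= l < L + (N delta).+1)%N ->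
     cover f (5 * eps) l (chain T alpha delta l) (Q l)) ->
  (forall l, (L <= l < L + (N delta).+1)%N -> Q l * (N delta).+1%:R <= expR (l%:R * beta)) ->
  exists2 C : R, 0 < C & forall n, (N delta <= n)%N ->
    cover f (5 * eps) n (FKPO T N alpha delta) (C * expR (n%:R * beta)).
Proof.
move=> e0 fB dense L0 Qc Qb; set M := N delta in Qc Qb *.
pose h n := (m%:R * expR B) ^+ n * expR (- (n%:R * beta)).
have h0 n : 0 <= h n by rewrite mulr_ge0 ?expR_ge0 // exprn_ge0 // mulr_ge0 ?expR_ge0.
pose A := \sum_(n < (L + M).+1) h n.
have A0 : 0 <= A by apply: sumr_ge0.
have ca := @cover_anchored R X T f alpha delta (5 * eps) M L Q A beta L0 Qc Qb.
(* words of length at most L + M, covered by the net alone, fix the constant A *)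
have {}ca n : cover f (5 * eps) n (anchored T alpha delta M) (A * expR (n%:R * beta)).
  apply: ca => {}n nLM; apply: cover_le (cover_all n e0 fB dense) _.
  rewrite -[leLHS]mulr1 -[X in _ * X <= _](expRxMexpNx_1 (n%:R * beta)) mulrCA mulrC.
  apply: ler_wpM2r; first exact: expR_ge0.
  rewrite /A (bigD1 (Ordinal (nLM : (n < (L + M).+1)%N))) //= lerDl.
  exact: sumr_ge0.
exists (\sum_(a <- iota 0 M.+1) h a * A + 1).
  by rewrite ltr_wpDl // sumr_ge0 // => a _; rewrite mulr_ge0.
move=> n Mn.
have H : cover f (5 * eps) n
   [set x | exists2 a, a \in iota 0 M.+1 & setT x /\ anchored T alpha delta M (shift a x)]
   (\sum_(a <- iota 0 M.+1) (m%:R * expR B) ^+ a * (A * expR ((n - a)%:R * beta))).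
  apply: cover_bigcup => a; rewrite mem_iota => aM.
  have an : (a <= n)%N by lia.
  rewrite -{1}(subnKC an); apply: cover_shift; last exact: ca.
  exact: cover_all.
apply: cover_sub (cover_le H _) _; last first.
  move=> x /pseudo_orbit_anchored[a aM ax]; exists a => //.
  by rewrite mem_iota.
apply: (@le_trans _ _ ((\sum_(a <- iota 0 M.+1) h a * A) * expR (n%:R * beta))); last first.
  by apply: ler_wpM2r; rewrite ?expR_ge0 // lerDl.
rewrite mulr_suml big_seq [leRHS]big_seq; apply: ler_sum => a; rewrite mem_iota => aM.
have an : (a <= n)%N by lia.
rewrite natrB // mulrBl expRD /h le_eqVlt; apply/orP; left; apply/eqP; ring.
Qed.

End PseudoOrbits.

(** * Growth rates and limits *)

Section Limits.
Set Implicit Arguments.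
Unset Strict Implicit.
Context {R : realType}.

Lemma limf_esup_lt (I : choiceType) (Y : filteredType I) (u : Y -> \bar R)
    (F : set_system Y) (r : \bar R) : Filter F ->
  (limf_esup u F < r)%E -> F [set y | (u y < r)%E].
Proof.
move=> FF /ereal_inf_lt[_ [V FV <-] supV]; apply: filterS FV => y Vy /=.
by apply: le_lt_trans supV; apply: ereal_sup_ubound; exists y.
Qed.

Lemma limf_esup_le (I : choiceType) (Y : filteredType I) (u : Y -> \bar R)
    (F : set_system Y) (r : \bar R) :
  F [set y | (u y <= r)%E] -> (limf_esup u F <= r)%E.
Proof.
move=> Fu; apply: ge_ereal_inf; exists (ereal_sup (u @` [set y | (u y <= r)%E])).
  by exists [set y | (u y <= r)%E].
by apply: ge_ereal_sup => _ [y uy <-].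
Qed.

Lemma lee_reals (x y : \bar R) : (forall r : R, (y < r%:E)%E -> (x <= r%:E)%E) -> (x <= y)%E.
Proof.
case: y => [y||] xy; last 2 first.
- exact: leey.
- case: x xy => [x||] xy; last 2 first.
  + by have := xy 0 (ltNyr 0).
  + by [].
  have := xy (x - 1) (ltNyr (x - 1)); rewrite lee_fin => h.
  by exfalso; lra.
apply/lee_addgt0Pr => e e0; rewrite -EFinD; apply: xy; rewrite lte_fin; lra.
Qed.

Lemma growth_lt (n : nat) (x : \bar R) (r : R) : (0 < n)%N ->
  ((n%:R^-1)%:E * lne x < r%:E)%E -> (x < (expR (n%:R * r))%:E)%E.
Proof.
move=> n0; rewrite lte_pdivrMl ?ltr0n // -EFinM; case: x => [x||] /=; last 2 first.
- by rewrite ltNge leey.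
- by move=> _; exact: ltNyr.
case: (leP x 0) => [x0 _|x0].
  by rewrite lte_fin; apply: le_lt_trans x0 (expR_gt0 _).
by rewrite !lte_fin -{2}(lnK x0) ltr_expR.
Qed.

Lemma growth_le (n : nat) (x : \bar R) (r : R) : (0 < n)%N ->
  (x <= (expR (n%:R * r))%:E)%E -> ((n%:R^-1)%:E * lne x <= r%:E)%E.
Proof.
move=> n0 /le_lne; rewrite lne_EFin ?expR_gt0 // expRK.
by rewrite lee_pdivrMl ?ltr0n // -EFinM.
Qed.

Section NonincreasingAtRight.
Variable g : R -> \bar R.
Hypothesis g_decr : forall a b, a <= b -> (g b <= g a)%E.

Lemma nonincreasing_le_lim (e : R) : 0 < e -> (g e <= lim (g e @[e --> 0^'+]))%E.
Proof.
move=> e0.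
have cvg_g : g x @[x --> 0^'+] --> ereal_sup [set g x | x in `]0, (e + 1)[%classic].
  apply: (@nonincreasing_at_right_cvge R g 0 (BLeft (e + 1))).
    by rewrite bnd_simp; lra.
  by move=> a b _ _; exact: g_decr.
rewrite (cvg_lim _ cvg_g) //; apply: ereal_sup_ubound; exists e => //=.
by rewrite in_itv /= e0; lra.
Qed.

Lemma nonincreasing_lim_le (e : R) (r : \bar R) : 0 < e ->
  (forall a, 0 < a -> a <= e -> (g a <= r)%E) -> (lim (g e @[e --> 0^'+]) <= r)%E.
Proof.
move=> e0 gr; apply: lime_le.
  by apply: nonincreasing_at_right_is_cvge; apply: nearW => x a b _ _; exact: g_decr.
near=> a; apply: gr; first by near: a; exact: nbhs_right_gt.
by near: a; exact: nbhs_right_le.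
Unshelve. all: by end_near. Qed.

End NonincreasingAtRight.
End Limits.

(** * The two inequalities *)

Section Inequalities.
Set Implicit Arguments.
Unset Strict Implicit.
Context {R : realType} {X : metricType R}.
Variables (T : X -> X) (f : X -> R) (N : R -> nat) (B : R).
Hypothesis f_bound : forall p, `|f p| <= B.
Hypothesis B_ge0 : 0 <= B.

Lemma expR_birkhoff_ge n (x : nat -> X) : expR (- (n%:R * B)) <= expR (birkhoff f n x).
Proof.
rewrite ler_expR -mulrN mulr_natl -[n in leLHS]card_ord -sumr_const; apply: ler_sum => i _.
by have := f_bound (x i); rewrite ler_norml => /andP[].
Qed.

(** A pseudo-orbit may be a true orbit, matched with itself by the identity. *)
Lemma orbit_FKPO (alpha delta : R) x : 0 <= alpha -> 0 < delta -> (0 < N delta)%N ->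
  FKPO T N alpha delta (fun i => iter i T x).
Proof.
move=> a0 d0 N0; exists id; split=> //.
  by move=> i; rewrite subSn // subnn.
move=> n p np; exists (p - n)%N; split.
- by rewrite subn_gt0 np /=.
- by rewrite mulrBl mul1r ltrBlDr ltrDl mulr_gt0 // ltr0n subn_gt0.
exists id, id; split=> // a b ->.
by rewrite subSn // subnn addnS /= mdistxx.
Qed.

(** Each element [y] of a spanning set of pseudo-orbits is replaced by a true orbit
    that follows it for [n] steps, if there is one. *)
Lemma sp_le_FKPOsp (eps alpha delta gam C : R) n : 0 < eps -> 0 <= alpha ->
  0 < delta -> (0 < N delta)%N ->
  (forall p q, mdist p q <= eps -> f p - f q <= gam) ->
  (FKPOsp T f N n eps alpha delta < C%:E)%E ->
  (sp T f n (2 * eps) <= (C * expR (n%:R * gam))%:E)%E.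
Proof.
move=> e0 a0 d0 N0 fgam /ereal_inf_lt[_ [F [FY Fspan] <-] FC].
have [s [Fs sC]] := finite_esum_lty (expR_gt0 (- (n%:R * B))) (expR_birkhoff_ge n) FC.
pose u := [seq ([set p | forall i, (i < n)%N -> mdist (iter i T p) (y i) < eps],
                expR (birkhoff f n y) * expR (n%:R * gam)) | y <- s].
have [||| G [_ Gu GC]] := @representatives R X
  (fun p => expR (birkhoff f n (fun i => iter i T p))) setT u.
- by move=> p; exact: expR_ge0.
- move=> U p /mapP[y ys ->] /= py; rewrite -expRD ler_expR -lerBlDl /birkhoff -sumrB.
  apply: le_trans (_ : \sum_(i < n) gam <= _).
    by apply: ler_sum => i _; apply/fgam/ltW/py.
  by rewrite sumr_const card_ord mulr_natl.
- by move=> U /mapP[y ys ->] /=; rewrite mulr_ge0 ?expR_ge0.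
apply: ge_ereal_inf; eexists; first exists G => //.
  move=> x; have [y Fy xy] := Fspan _ (orbit_FKPO x a0 d0 N0).
  have ys : y \in s by move: Fy; rewrite Fs.
  have [z Gz zy] := Gu _ x (map_f _ ys) I xy; exists z => //.
  apply: bigmax_le => [|i _]; first by lra.
  apply: le_trans (metric_triangle _ (y i) _) _; rewrite (metric_sym (y i)).
  by apply: le_trans (lerD (ltW (xy i (ltn_ord i))) (ltW (zy i (ltn_ord i)))) _; lra.
apply: le_trans GC _; rewrite lee_fin big_map /= -mulr_suml.
by apply: ler_wpM2r; rewrite ?expR_ge0.
Qed.

Lemma pressure_eps_le (eps gam r : R) : 0 < eps ->
  (forall delta, 0 < delta -> (0 < N delta)%N) ->
  (forall p q, mdist p q <= eps -> f p - f q <= gam) ->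
  (PFKPO_eps T f N eps < r%:E)%E -> (pressure_eps T f (2 * eps) <= (r + gam)%:E)%E.
Proof.
move=> e0 N0 fgam /limf_esup_lt near_r.
have [delta [d0 /ereal_inf_lt[_ [alpha /= a0 <-] ar]]] :=
  filter_ex (filterI (nbhs_right_gt 0) near_r).
apply: limf_esup_le; apply: filterS2 (nbhs_infty_gt 0) (limf_esup_lt _ ar) => n /= n0.
move=> /(growth_lt n0) nr; apply: growth_le => //.
rewrite mulrDr expRD; apply: (sp_le_FKPOsp e0 (ltW a0) d0 (N0 _ d0)) => //.
Qed.

(** Order of the choices: the net and [kappa] depend on [eps] and [eta], then
    [delta] is small, [L] is large with respect to [N delta], [alpha] is small with
    respect to [L + N delta], and finally [n] is large. *)
Lemma PFKPO_eps_le (eps gam eta r : R) : compact [set: X] -> continuous T ->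
  0 < eps -> 0 <= gam -> 0 < eta ->
  (forall p q, mdist p q <= 2 * eps -> f p - f q <= gam) ->
  (pressure_eps T f eps < r%:E)%E ->
  (PFKPO_eps T f N (5 * eps) <= (r + gam + 4 * eta)%:E)%E.
Proof.
move=> cX cT e0 g0 eta0 fgam /limf_esup_lt[n0 _ spr].
have [m [net dense]] := compact_net cX e0.
have B0 := B_ge0.
(* so that expR kappa > kappa makes the rate of the codes at most eta *)
pose kappa : R := (m.+1 * 2)%:R / eta.
have k0 : 0 <= kappa by rewrite divr_ge0 // ltW.
have c0 : 0 < 2 * B + 2 * kappa + 1 by lra.
have keta : expR (- kappa) *+ (m.+1 * 2) <= eta.
  rewrite expRN -mulr_natl ler_pdivrMr ?expR_gt0 // mulrC -ler_pdivrMr //.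
  by apply: le_trans (expR_ge1Dx _); rewrite lerDr.
apply: limf_esup_le; near=> delta.
have d0 : 0 < delta by near: delta; exact: nbhs_right_gt.
have dsmall : (2 * B + 2 * kappa) * delta <= eta.
  apply: le_trans (_ : (2 * B + 2 * kappa + 1) * delta <= _).
    by rewrite ler_pM2r // lerDl.
  rewrite mulrC -ler_pdivlMr // ltW //.
  by near: delta; apply: nbhs_right_lt; rewrite divr_gt0.
set M := N delta.
(* long enough for the spanning sets to grow at rate r and for
   ln (M + 1) <= M <= L * eta *)
pose L := (n0 + Num.truncn (M%:R / eta)).+1.
have ML : M%:R <= L%:R * eta.
  rewrite -ler_pdivrMr //; apply: le_trans (ltW (truncnS_gt _)) _.
  by rewrite ler_nat ltnS leq_addl.
have [alpha a0 tr] := traces_exists cX cT (L + M) e0.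
pose Q l : R := expR (l%:R * r) * expR (l%:R * (gam + 2 * eta)).
have Qc l : (L <= l < L + M.+1)%N -> cover f (5 * eps) l (chain T alpha delta l) (Q l).
  move=> /andP[Ll lLM].
  have lK : (l <= L + M)%N by rewrite -ltnS -addnS.
  have l0 : (0 < l)%N by apply: leq_trans Ll.
  have /(growth_lt l0)/ereal_inf_lt[_ [F Fsp <-] Fl] := spr l (leq_trans (leqW (leq_addr _ _)) Ll).
  have [s [Fs sl]] := finite_esum_lty (expR_gt0 (- (l%:R * B)))
    (fun p => expR_birkhoff_ge l (fun i => iter i T p)) Fl.
  have sspan p : exists2 e, e \in s & bowen_dist T l p e <= eps.
    by have [e Fe pe] := Fsp p; exists e => //; move: Fe; rewrite Fs.
  have trl : traces T alpha l eps.
    move=> k z j kl jl; apply: tr; first exact: leq_trans kl lK.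
    by move=> t /jl /andP[-> /leq_trans]; apply.
  apply: cover_le (cover_chains delta f_bound fgam e0 g0 dense B0 k0 trl sspan) _.
  apply: ler_pM; rewrite ?expR_ge0 //; first by rewrite sumr_ge0 // => e _; rewrite expR_ge0.
  by rewrite ler_expR; apply: ler_wpM2l => //; lra.
have Qb l : (L <= l < L + M.+1)%N -> Q l * M.+1%:R <= expR (l%:R * (r + gam + 3 * eta)).
  move=> /andP[Ll _]; rewrite /Q -expRD.
  apply: le_trans (_ : expR (l%:R * r + l%:R * (gam + 2 * eta)) * expR (l%:R * eta) <= _); last first.
    by rewrite -expRD ler_expR; lra.
  apply: ler_wpM2l; rewrite ?expR_ge0 //.
  apply: le_trans (_ : 1 + l%:R * eta <= _); last exact: expR_ge1Dx.
  rewrite -natr1 addrC lerD2l; apply: le_trans ML _.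
  by rewrite ler_wpM2r ?ler_nat // ltW.
have fB p : f p <= B by apply: le_trans (ler_norm _) (f_bound p).
have [C C0 cov] := cover_FKPO e0 fB dense (ltn0Sn _) Qc Qb.
apply: ge_ereal_inf; eexists; first by exists alpha.
apply: limf_esup_le; near=> n.
have n1 : (0 < n)%N by near: n; exact: nbhs_infty_gt.
apply: growth_le => //.
have Mn : (M <= n)%N by near: n; exact: nbhs_infty_ge.
have Cn : C <= expR (n%:R * eta).
  rewrite -[leLHS](lnK C0) ler_expR -ler_pdivrMr //.
  apply: le_trans (ltW (truncnS_gt _)) _; rewrite ler_nat.
  by near: n; exact: nbhs_infty_ge.
have [F Fspan FC] := cover_spanning (cov n Mn).
apply: ge_ereal_inf; eexists; first by exists F.
apply: le_trans FC _; rewrite lee_fin.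
apply: le_trans (_ : expR (n%:R * eta) * expR (n%:R * (r + gam + 3 * eta)) <= _).
  by apply: ler_wpM2r; rewrite ?expR_ge0.
by rewrite -expRD ler_expR; lra.
Unshelve. all: by end_near. Qed.

End Inequalities.

Theorem theorem2p7 (R : realType) (X : metricType R) (T : X -> X) (f : X -> R)
    (N : R -> nat) (compactX : compact [set: X]) (contT : continuous T)
    (contf : continuous f) (N_gt0 : forall delta : R, 0 < delta -> (0 < N delta)%N) :
  PFKPO T f N = pressure T f.
Proof.
have [B B0 fB] := compact_bounded_fun compactX contf.
have fmod (e : R) : 0 < e -> exists2 d : R, 0 < d &
    forall p q, mdist p q <= d -> f p - f q <= e.
  move=> e0; have [d d0 df] := compact_unif_continuous compactX contf e0.
  exists d => // p q /df; rewrite -ball_normE /= => /ltW.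
  exact: le_trans (ler_norm _).
apply/eqP; rewrite eq_le; apply/andP; split; apply: lee_reals => r lt_r;
    apply/lee_addgt0Pr => eta eta0; rewrite -EFinD.
  have eta5 : 0 < eta / 5 by rewrite divr_gt0.
  have [d d0 fd] := fmod _ eta5.
  apply: (nonincreasing_lim_le (@PFKPO_eps_nonincreasing R X T f N) d0) => e e0 ed.
  have e5 : 0 < e / 5 by rewrite divr_gt0.
  have -> : e = 5 * (e / 5) by field.
  have -> : r + eta = r + eta / 5 + 4 * (eta / 5) by field.
  apply: (PFKPO_eps_le N fB B0 compactX contT e5 (ltW eta5) eta5).
    by move=> p q pq; apply: fd; apply: le_trans pq _; lra.
  apply: le_lt_trans lt_r.
  exact: (nonincreasing_le_lim (@pressure_eps_nonincreasing R X T f)).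
have [d d0 fd] := fmod _ eta0.
have d20 : 0 < 2 * d by rewrite mulr_gt0.
apply: (nonincreasing_lim_le (@pressure_eps_nonincreasing R X T f) d20) => e e0 ed.
have e2 : 0 < e / 2 by rewrite divr_gt0.
have -> : e = 2 * (e / 2) by field.
apply: (pressure_eps_le fB e2 N_gt0).
  by move=> p q pq; apply: fd; apply: le_trans pq _; lra.
apply: le_lt_trans lt_r.
exact: (nonincreasing_le_lim (@PFKPO_eps_nonincreasing R X T f N)).
Qed.
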